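(* Let $\ell$ be a positive integer. Let $X_1,\dots,X_\ell$ be subvarieties of $\mathbb{P}^n$ whose linear spans are generic of dimensions $h_1,\dots,h_\ell$, respectively. If $n\geq N=(h_1+1)\cdots(h_\ell+1)-1$, then the Hadamard product $X_1\star\cdots\star X_\ell$ and the product variety $X_1\times\cdots\times X_\ell$ are projectively equivalent as subvarieties of $\mathbb{P}^n$.
   Context: The base field $\mathbb{K}$ is algebraically closed of characteristic $0$; all varieties are irreducible (closed subvarieties of projective space). Hadamard product: for subvarieties $X_1,\dots,X_\ell\subseteq\mathbb{P}^n$, $X_1\star\cdots\star X_\ell$ is the Zariski closure in $\mathbb{P}^n$ of the image of the rational map $X_1\times\cdots\times X_\ell\dashrightarrow\mathbb{P}^n$ given by coordinatewise multiplication of homogeneous coordinates (for $\ell=2$: $([a_0:\dots:a_n],[b_0:\dots:b_n])\mapsto[a_0b_0:a_1b_1:\dots:a_nb_n]$). Genericity: ''the linear spans are generic of dimensions $h_1,\dots,h_\ell$'' means that the tuple $(L_1,\dots,L_\ell)$ of linear spans ($L_i$ a linear subspace of $\mathbb{P}^n$ of dimension $h_i$) lies in a suitable nonempty Zariski-open subset, depending only on $n,h_1,\dots,h_\ell$, of the space of all such tuples (parameterized by the coefficients of linear parametric equations of the $L_i$). For tuples in this open set the assertion holds for all subvarieties $X_i$ with linear span $L_i$. Embedding of the product: identifying each $L_i$ with $\mathbb{P}^{h_i}$ through a linear parameterization, $X_1\times\cdots\times X_\ell\subseteq\mathbb{P}^{h_1}\times\cdots\times\mathbb{P}^{h_\ell}$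 is regarded as a subvariety of $\mathbb{P}^n$ via the map $\sigma$, the composition of the Segre embedding $\mathbb{P}^{h_1}\times\cdots\times\mathbb{P}^{h_\ell}\to\mathbb{P}^N$ with the linear inclusion $\mathbb{P}^N\hookrightarrow\mathbb{P}^n$, $[a_0:\dots:a_N]\mapsto[a_0:\dots:a_N:0:\dots:0]$. Two subvarieties of $\mathbb{P}^n$ are projectively equivalent if some projective linear automorphism of $\mathbb{P}^n$ maps one onto the other. *)

(* Defs.v *)
From HB Require Import structures.
From mathcomp Require Import all_boot all_order all_algebra.
From mathcomp.multinomials Require Import mpoly.

Set Implicit Arguments.
Unset Strict Implicit.
Unset Printing Implicit Defensive.

Import GRing.Theory.
Local Open Scope ring_scope.

(** Points of P^n are given by nonzero homogeneous coordinate vectors in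
    'rV[K]_n.+1, and a subset of P^n by the predicate selecting all the
    homogeneous coordinate vectors of its points.  Closed sets contain no zero
    vector and are automatically stable under nonzero scaling. *)

Section Projective.
Variables (K : closedFieldType) (n : nat).
Implicit Types (X Y Z A : 'rV[K]_n.+1 -> Prop) (v w : 'rV[K]_n.+1).
Implicit Types L : {vspace 'rV[K]_n.+1}.

Definition same_point v w := exists2 c : K, c != 0 & v = c *: w.

Definition homogeneous (p : {mpoly K[n.+1]}) := exists d, p \is d.-homog.

Definition pclosed X :=
  exists S : {mpoly K[n.+1]} -> Prop,
    (forall p, S p -> homogeneous p) /\
    forall v, X v <-> v != 0 /\ forall p, S p -> p.@[fun j => v ord0 j] = 0.

Definition pclosure A v := forall Y, pclosed Y -> (forall w, A w -> Y w) -> Y v.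

Definition pirreducible X :=
  (exists v, X v) /\
  forall Y Z, pclosed Y -> pclosed Z -> (forall v, X v -> Y v \/ Z v) ->
    (forall v, X v -> Y v) \/ (forall v, X v -> Z v).

Definition subvariety X := pclosed X /\ pirreducible X.

(** The linear subspaces of P^n of dimension h are the P(L) with
    \dim L = h.+1. *)
Definition linear_span_is X L :=
  (forall v, X v -> v \in L) /\
  forall L', (forall v, X v -> v \in L') -> (L <= L')%VS.

Definition projectively_equivalent X Y :=
  exists2 A : 'M[K]_n.+1, A \in unitmx & forall v, X v <-> Y (v *m A).

Definition hadamard_image (l : nat) (X : 'I_l -> 'rV[K]_n.+1 -> Prop) v :=
  v != 0 /\
  exists a : 'I_l -> 'rV[K]_n.+1,
    (forall i, X i (a i)) /\ same_point v (\row_j \prod_i a i ord0 j).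

Definition hadamard_product (l : nat) (X : 'I_l -> 'rV[K]_n.+1 -> Prop) :=
  pclosure (hadamard_image X).

End Projective.

(** A linear parametrization P^h -> P^n, x |-> x *m M, of its image; it is
    injective exactly when M is row_free. *)
Definition param_space (K : closedFieldType) (h n : nat)
    (M : 'M[K]_(h.+1, n.+1)) : {vspace 'rV[K]_n.+1} :=
  limg (linfun (mulmxr M : 'rV[K]_h.+1 -> 'rV[K]_n.+1)).

Section Genericity.
Variables (K : closedFieldType) (n l : nat) (h : 'I_l -> nat).

Definition coef_index := {i : 'I_l & ('I_(h i).+1 * 'I_n.+1)%type}.

Definition coef (M : forall i, 'M[K]_((h i).+1, n.+1)) (t : coef_index) : K :=
  M (tag t) (tagged t).1 (tagged t).2.

(** Zariski-open subsets of the affine space of all the tuples M. *)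
Definition zariski_open (V : (forall i, 'M[K]_((h i).+1, n.+1)) -> Prop) :=
  exists S : {mpoly K[#|{: coef_index}|]} -> Prop,
    forall M, V M <->
      exists2 p, S p & p.@[fun k => coef M (enum_val k)] != 0.

(** U, a set of tuples of linear subspaces of dimensions h i of P^n, is open
    and nonempty: the full-rank parameters of the tuples in U form a nonempty
    open set. *)
Definition nonempty_open_tuples
    (U : ('I_l -> {vspace 'rV[K]_n.+1}) -> Prop) :=
  let V (M : forall i, 'M[K]_((h i).+1, n.+1)) :=
    (forall i, row_free (M i)) /\ U (fun i => param_space (M i)) in
  zariski_open V /\ exists M, V M.

End Genericity.

Section Segre.
Variables (K : closedFieldType) (l : nat) (h : 'I_l -> nat).

Definition segre_dim := (\prod_i (h i).+1).-1.

Lemma card_segre_index :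
  #|{dffun forall i : 'I_l, 'I_(h i).+1}| = segre_dim.+1.
Proof.
rewrite card_dep_ffun /segre_dim prednK ?prodn_gt0 // foldrE big_map big_enum.
by apply: eq_bigr => i _; rewrite card_ord.
Qed.

Definition segre_index (k : 'I_segre_dim.+1) :
    {dffun forall i : 'I_l, 'I_(h i).+1} :=
  enum_val (cast_ord (esym card_segre_index) k).

Definition segre (x : forall i, 'rV[K]_(h i).+1) : 'rV[K]_segre_dim.+1 :=
  \row_k \prod_i x i ord0 (segre_index k i).

Variable n : nat.

(** For segre_dim <= n, multiplication by pid_mx pads with zeros. *)
Definition sigma (x : forall i, 'rV[K]_(h i).+1) : 'rV[K]_n.+1 :=
  segre x *m pid_mx segre_dim.+1.

(** The product of the X i, each seen in P^(h i) through the parametrization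
    M i of its linear span, as a subset of P^n. *)
Definition product_variety (M : forall i, 'M[K]_((h i).+1, n.+1))
    (X : 'I_l -> 'rV[K]_n.+1 -> Prop) (v : 'rV[K]_n.+1) :=
  exists x : forall i, 'rV[K]_(h i).+1,
    (forall i, X i (x i *m M i)) /\ same_point v (sigma x).

End Segre.

(* Main.v *)
Require Import Defs.
From HB Require Import structures.
From mathcomp Require Import all_boot all_order all_algebra.
From mathcomp.multinomials Require Import mpoly.

Set Implicit Arguments.
Unset Strict Implicit.
Unset Printing Implicit Defensive.

Import GRing.Theory.
Local Open Scope ring_scope.

(** The theorem rests on one identity.  If [x i] is the coordinate vector of a
    point of the i-th linear span in the parametrization [M i], expanding the
    product of the linear forms [(x i *m M i) j] over [i] gives

      [\row_j \prod_i (x i *m M i) ord0 j = segre x *m hadamard_matrix M],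

    where the row of [hadamard_matrix M] at the multi-index [k] is the
    coordinatewise product of the rows [k i] of the [M i]
    ([segre_mul_hadamard_matrix]).  So the Hadamard product map is the Segre map
    followed by a fixed linear map.  When [hadamard_matrix M] has independent
    rows, some invertible [A] carries it to the matrix padding with zeros, and
    [A] then carries the image of the Hadamard product map onto the product
    variety ([hadamard_image_product]).

    The Hadamard product is the closure of that image, so it remains to see that
    the product variety is already closed ([pclosed_product_variety]).  Fix a
    nonzero Segre coordinate, of multi-index [k], of a point [v].  Letting one
    index of [k] vary at a time gives vectors [x i] depending linearly on [v],
    and up to a common factor they are the only candidates for the factors of
    [v].  That [v] is their Segre image, and that they lie on the [X i], are
    homogeneous polynomial conditions on [v].

    Genericity is the full row rank of [hadamard_matrix M].  It is a
    Zariski-open condition ([zariski_open_row_free]), it depends only on the row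
    spaces of the [M i] ([hadamard_matrix_submx]), and it holds for a tuple of
    0-1 matrices making [hadamard_matrix M] contain an identity block
    ([exists_row_free_hadamard_matrix]). *)

Local Notation peval p v := (p.@[fun j => v ord0 j]).

(** * Homogeneous polynomials under linear substitution *)

Section HomogeneousPolynomials.
Variable R : comNzRingType.

Lemma dhomog_bigprod n (I : Type) (r : seq I) (F : I -> {mpoly R[n]})
    (d : I -> nat) :
  (forall i, F i \is (d i).-homog) ->
  \prod_(i <- r) F i \is (\sum_(i <- r) d i)%N.-homog.
Proof.
move=> hF.
apply: (big_ind2 (fun e (p : {mpoly R[n]}) => p \is e.-homog)) => //.
  exact: dhomog1.
by move=> d1 p1 d2 p2; apply: dhomogM.
Qed.

Lemma meval_dhomog_scale n d (p : {mpoly R[n.+1]}) c (v : 'rV[R]_n.+1) :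
  p \is d.-homog -> peval p (c *: v) = c ^+ d * peval p v.
Proof.
move=> /dhomogP hp; rewrite !mevalE big_distrr big_seq [RHS]big_seq /=.
apply: eq_bigr => m /hp <-; rewrite mulrCA; congr (_ * _).
rewrite /= mdegE -prodrXr -big_split /=.
by apply: eq_bigr => i _; rewrite mxE exprMn.
Qed.

Definition linform n m (C : 'M[R]_(n, m)) (j : 'I_m) : {mpoly R[n]} :=
  \sum_i C i j *: 'X_i.

Lemma linform_homog n m (C : 'M[R]_(n, m)) j : linform C j \is 1.-homog.
Proof. by apply: rpred_sum => i _; rewrite rpredZ // dhomogX /= mdeg1. Qed.

Lemma meval_linform n m (C : 'M[R]_(n.+1, m)) j (v : 'rV[R]_n.+1) :
  peval (linform C j) v = (v *m C) ord0 j.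
Proof.
rewrite mxE raddf_sum; apply: eq_bigr => i _ /=.
by rewrite mevalZ mevalXU mulrC.
Qed.

Definition pullback n m (C : 'M[R]_(n, m)) (p : {mpoly R[m]}) :=
  p \mPo [tuple linform C j | j < m].

Lemma pullback_homog n m (C : 'M[R]_(n, m)) d (p : {mpoly R[m]}) :
  p \is d.-homog -> pullback C p \is d.-homog.
Proof.
move=> /dhomogP hp; rewrite /pullback comp_mpolyE big_seq.
apply: rpred_sum => mm /hp <-; rewrite rpredZ //= mdegE.
apply: dhomog_bigprod => i; rewrite tnth_mktuple.
by have := dhomogMn (mm i) (linform_homog C i); rewrite mul1n.
Qed.

Lemma meval_pullback n m (C : 'M[R]_(n.+1, m.+1)) p (v : 'rV[R]_n.+1) :
  peval (pullback C p) v = peval p (v *m C).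
Proof.
rewrite comp_mpoly_meval; apply: meval_eq => j.
by rewrite tnth_mktuple meval_linform.
Qed.

End HomogeneousPolynomials.

(** * Closed subsets of projective space *)

Section ClosedSets.
Variables (K : closedFieldType) (n : nat).
Implicit Types X Y A : 'rV[K]_n.+1 -> Prop.

(** It suffices to cut out each point outside [X] separately: the equations of
    [X] can be all the homogeneous polynomials vanishing on it. *)
Lemma pclosed_of_vanishing X :
  (forall v, X v -> v != 0) ->
  (forall v : 'rV[K]_n.+1, v != 0 ->
     (forall p, homogeneous p -> (forall w, X w -> peval p w = 0) ->
        peval p v = 0) -> X v) ->
  pclosed X.
Proof.
move=> X0 XI.
exists (fun p => homogeneous p /\ forall w, X w -> peval p w = 0).
split=> [p [] //|v]; split=> [Xv|[v0 vS]].
  by split=> [|p [_]]; [exact: X0 | exact].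
by apply: XI => // p hp pX; apply: vS.
Qed.

Lemma pclosed_preim (C : 'M[K]_n.+1) Y :
  C \in unitmx -> pclosed Y -> pclosed (fun v => Y (v *m C)).
Proof.
move=> uC [S [hS YS]].
exists (fun q => exists2 p, S p & q = pullback C p); split.
  by move=> _ [p /hS[d hp] ->]; exists d; apply: pullback_homog.
have nz v : (v *m C != 0) = (v != 0).
  by rewrite -[in LHS](mul0mx _ C) (inj_eq (can_inj (mulmxK uC))).
move=> v; rewrite YS nz; split=> -[v0 vS]; split=> // p.
  by move=> [q Sq ->]; rewrite meval_pullback; apply: vS.
by move=> Sp; rewrite -meval_pullback; apply: vS; exists p.
Qed.

Lemma pclosure_id A Y :
  pclosed Y -> (forall v, A v <-> Y v) -> forall v, pclosure A v <-> Y v.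
Proof.
by move=> cY AY v; split=> [|/AY Av Z _]; [apply=> // w /AY | exact].
Qed.

End ClosedSets.

(** * The Hadamard product map as a linear image of the Segre map *)

Section SegreCoordinates.
Variables (K : closedFieldType) (l : nat) (h : 'I_l -> nat).

Local Notation multi_index := {dffun forall i : 'I_l, 'I_(h i).+1}.

Definition segre_rank (k : multi_index) : 'I_(segre_dim h).+1 :=
  cast_ord (card_segre_index h) (enum_rank k).

Lemma segre_rankK : cancel segre_rank (@segre_index l h).
Proof. by move=> k; rewrite /segre_index cast_ordK enum_rankK. Qed.

Lemma segre_indexK : cancel (@segre_index l h) segre_rank.
Proof. by move=> k; rewrite /segre_rank enum_valK cast_ordKV. Qed.

Definition upd (k : multi_index) (i : 'I_l) (a : 'I_(h i).+1) : multi_index :=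
  [ffun j => dfwith k a j].

Lemma upd_in k i (a : 'I_(h i).+1) : upd k a i = a.
Proof. by rewrite ffunE dfwith_in. Qed.

Lemma upd_out k i (a : 'I_(h i).+1) j : i != j -> upd k a j = k j.
Proof. by move=> ne; rewrite ffunE dfwith_out. Qed.

Lemma upd_id k i : upd k (k i) = k.
Proof. by apply/ffunP => j; rewrite ffunE; case: dfwithP. Qed.

Lemma prod_upd (x : forall i, 'rV[K]_(h i).+1) k i (a : 'I_(h i).+1) :
  \prod_j x j ord0 (upd k a j) =
  (\prod_(j | j != i) x j ord0 (k j)) * x i ord0 a.
Proof.
rewrite (bigD1 i) //= upd_in mulrC; congr (_ * _).
by apply: eq_bigr => j ne; rewrite upd_out // eq_sym.
Qed.

Lemma segreE (x : forall i, 'rV[K]_(h i).+1) k :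
  segre x ord0 (segre_rank k) = \prod_i x i ord0 (k i).
Proof. by rewrite mxE segre_rankK. Qed.

Lemma segre_neq0 (x : forall i, 'rV[K]_(h i).+1) :
  (forall i, x i != 0) -> segre x != 0.
Proof.
move=> x0; have c i : exists a, x i ord0 a != 0 by apply/rV0Pn/x0.
pose k : multi_index := [ffun i => xchoose (c i)].
apply/rV0Pn; exists (segre_rank k); rewrite segreE.
by apply/prodf_neq0 => i _; rewrite ffunE; exact: (xchooseP (c i)).
Qed.

(** Distributivity when the range of the inner sum depends on [i]; passing
    through [fprod] reduces it to the case of a constant range. *)
Lemma prod_sum_dffun (F : forall i, 'I_(h i).+1 -> K) :
  \prod_i \sum_a F i a = \sum_(k : multi_index) \prod_i F i (k i).
Proof.
pose T_ (i : 'I_l) : finType := 'I_(h i).+1.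
rewrite (reindex (@dffun_of_fprod _ T_)) /=; last first.
  exact/onW_bij/dffun_of_fprod_bij.
pose P_ i : {ffun T_ i -> K} := [ffun a => F i a].
transitivity (\sum_(t : fprod T_) \prod_(i in 'I_l) P_ i (t i)).
  rewrite big_fprod.
  transitivity (\prod_i \sum_(u in tagged_with T_ i) untag 0 (P_ i) u).
    apply: eq_bigr => i _; rewrite -(big_tag (fun i => P_ i)).
    by apply: eq_bigr => a _; rewrite ffunE.
  exact: (bigA_distr_big_dep (tagged_with T_)
                             (fun i => untag 0 (P_ i))).
by apply: eq_bigr => t _; apply: eq_bigr => i _; rewrite !ffunE.
Qed.

Variable n : nat.
Implicit Types M : forall i, 'M[K]_((h i).+1, n.+1).

Definition hadamard_matrix M : 'M[K]_((segre_dim h).+1, n.+1) :=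
  \matrix_(k, j) \prod_i M i (segre_index k i) j.

Lemma segre_mul_hadamard_matrix M x :
  segre x *m hadamard_matrix M = \row_j \prod_i (x i *m M i) ord0 j.
Proof.
apply/rowP => j; rewrite !mxE.
under [RHS]eq_bigr do rewrite mxE.
rewrite prod_sum_dffun [RHS](reindex (@segre_index l h)) /=; last first.
  by exists segre_rank => k _; [apply: segre_indexK | apply: segre_rankK].
by apply: eq_bigr => k _; rewrite !mxE -big_split.
Qed.

(** A relation [u] between the rows of [M i], completed by nonzero vectors in
    the other factors, has a nonzero Segre image, which is a relation between
    the rows of [hadamard_matrix M].  Hence the rank condition on the tuple
    already contains the rank conditions on its members. *)
Lemma row_free_of_hadamard_matrix M i :
  row_free (hadamard_matrix M) -> row_free (M i).
Proof.
move=> fB; apply/inj_row_free => u uM; apply/eqP.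
pose x := @dfwith _ (fun j => 'rV[K]_(h j).+1) (fun=> const_mx 1) i u.
apply: contraT => u0.
have /segre_neq0 : forall j, x j != 0.
  move=> j; rewrite /x; case: dfwithP => // j' _.
  by apply/negP => /eqP/rowP/(_ ord0)/eqP; rewrite !mxE oner_eq0.
case/eqP; apply: (row_free_inj fB); rewrite mul0mx segre_mul_hadamard_matrix.
by apply/rowP => j; rewrite !mxE (bigD1 i) //= /x dfwith_in uM mxE mul0r.
Qed.

(** Each row of [hadamard_matrix M] is a coordinatewise product of vectors in
    the row spaces of the [M' i], hence the image of a Segre vector.  This makes
    the rank of [hadamard_matrix M] a function of the row spaces alone. *)
Lemma hadamard_matrix_submx M M' :
  (forall i, M i <= M' i)%MS -> (hadamard_matrix M <= hadamard_matrix M')%MS.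
Proof.
move=> sub; apply/row_subP => k.
pose x i : 'rV[K]_(h i).+1 := row (segre_index k i) (M i) *m pinvmx (M' i).
apply/submxP; exists (segre x); rewrite segre_mul_hadamard_matrix.
apply/rowP => j; rewrite !mxE; apply: eq_bigr => i _.
by rewrite mulmxKpV ?mxE // (submx_trans (row_sub _ _)).
Qed.

End SegreCoordinates.

(** * Genericity: tuples whose Hadamard matrix has full row rank *)

Lemma mem_param_space (K : closedFieldType) h n (M : 'M[K]_(h.+1, n.+1)) v :
  (v \in param_space M) = (v <= M)%MS.
Proof.
apply/memv_imgP/submxP => [[x _ ->]|[x ->]].
  by exists x; rewrite lfunE.
by exists x; rewrite ?memvf // lfunE.
Qed.

Section Genericity.
Variables (K : closedFieldType) (l n : nat) (h : 'I_l -> nat).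
Implicit Types M : forall i, 'M[K]_((h i).+1, n.+1).

Definition hadamard_mpoly : 'M[{mpoly K[#|{: coef_index n h}|]}]_(_, n.+1) :=
  \matrix_(k < (segre_dim h).+1, j < n.+1)
    \prod_i 'X_(enum_rank (Tagged (fun i => 'I_(h i).+1 * 'I_n.+1)%type
                                  (segre_index k i, j) : coef_index n h)).

Lemma meval_hadamard_mpoly M :
  map_mx (meval (fun k => coef M (enum_val k))) hadamard_mpoly =
  hadamard_matrix M.
Proof.
apply/matrixP => k j; rewrite !mxE rmorph_prod; apply: eq_bigr => i _.
by rewrite /= mevalXU enum_rankK.
Qed.

(** Having a right inverse [C] gives [\det (hadamard_matrix M *m C) != 0], and
    conversely such a determinant forces full row rank; letting [C] range over
    all constant matrices avoids a choice of minors. *)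
Lemma zariski_open_row_free :
  zariski_open (fun M => row_free (hadamard_matrix M)).
Proof.
exists (fun p => exists C : 'M[K]_(n.+1, (segre_dim h).+1),
  p = \det (hadamard_mpoly *m map_mx (@mpolyC _ K) C)) => M.
have ev C : (\det (hadamard_mpoly *m map_mx (@mpolyC _ K) C)).@[
    fun k => coef M (enum_val k)] = \det (hadamard_matrix M *m C).
  rewrite -det_map_mx map_mxM meval_hadamard_mpoly -map_mx_comp.
  by congr (\det (_ *m _)); apply/matrixP => a b; rewrite !mxE /= mevalC.
split=> [/row_freeP[C BC]|[_ [C ->]]].
  exists (\det (hadamard_mpoly *m map_mx (@mpolyC _ K) C)); first by exists C.
  by rewrite ev BC det1 oner_neq0.
rewrite ev -unitfE => detu.
have /eqP rk : row_free (hadamard_matrix M *m C).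
  by rewrite row_free_unit unitmxE.
by rewrite /row_free eqn_leq rank_leq_row -{1}rk mxrankM_maxl.
Qed.

Lemma exists_row_free_hadamard_matrix :
  (segre_dim h <= n)%N -> exists M, row_free (hadamard_matrix M).
Proof.
move=> le_Nn.
(* Column j of M i is the basis vector of index (segre_index j i), so column j
   of the Hadamard matrix is the basis vector of index j, for j up to
   segre_dim h. *)
pose M i : 'M[K]_((h i).+1, n.+1) :=
  \matrix_(a, j) (segre_index (inord j : 'I_(segre_dim h).+1) i == a)%:R.
have le : ((segre_dim h).+1 <= n.+1)%N by [].
exists M; apply/row_freeP; exists (colsub (widen_ord le) 1%:M).
rewrite mulmx_colsub mulmx1; apply/matrixP => k k'; rewrite !mxE.
have inordK' : inord (widen_ord le k') = k' by apply/val_inj; rewrite /= inordK.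
have [->|ne] := eqVneq k k'.
  by apply: big1 => i _; rewrite mxE inordK' eqxx.
have /existsP[i nei] : [exists i, segre_index k' i != segre_index k i].
  apply: contraNT ne; rewrite negb_exists => /forallP e.
  apply/eqP/(can_inj (@segre_indexK l h))/ffunP => i.
  by apply/esym/eqP/negPn/e.
by rewrite (bigD1 i) //= mxE inordK' (negPf nei) mul0r.
Qed.

End Genericity.

(** * The product variety is closed *)

Section ProductVariety.
Variables (K : closedFieldType) (l n : nat) (h : 'I_l -> nat).
Variables (l_gt0 : (0 < l)%N) (le_Nn : (segre_dim h <= n)%N).
Implicit Types (M : forall i, 'M[K]_((h i).+1, n.+1)) (v w : 'rV[K]_n.+1).
Implicit Types X : 'I_l -> 'rV[K]_n.+1 -> Prop.

Local Notation multi_index := {dffun forall i : 'I_l, 'I_(h i).+1}.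

Definition unpad_mx : 'M[K]_(n.+1, (segre_dim h).+1) := pid_mx (segre_dim h).+1.

Lemma sigma_unpad (x : forall i, 'rV[K]_(h i).+1) :
  sigma n x *m unpad_mx = segre x.
Proof. by rewrite -mulmxA pid_mx_id // pid_mx_1 mulmx1. Qed.

Lemma sigma_neq0 (x : forall i, 'rV[K]_(h i).+1) :
  (forall i, x i != 0) -> sigma n x != 0.
Proof.
move/segre_neq0; apply: contra_neq => sx0.
by rewrite -sigma_unpad sx0 mul0mx.
Qed.

Definition segre_coord (k : multi_index) v :=
  (v *m unpad_mx) ord0 (segre_rank k).

(** The coordinates of [v] at the multi-indices that differ from [k] at most
    at [i]; on the Segre variety they are proportional to the i-th factor. *)
Definition slice_mx (k : multi_index) i : 'M[K]_(n.+1, (h i).+1) :=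
  colsub (fun a => segre_rank (upd k a)) unpad_mx.

Lemma slice_mxE k i v a :
  (v *m slice_mx k i) ord0 a = segre_coord (upd k a) v.
Proof. by rewrite mulmx_colsub mxE. Qed.

Lemma segre_coord_sigma k c (x : forall i, 'rV[K]_(h i).+1) :
  segre_coord k (c *: sigma n x) = c * \prod_i x i ord0 (k i).
Proof. by rewrite /segre_coord -scalemxAl mxE sigma_unpad segreE. Qed.

Lemma slice_sigma k i c (x : forall i, 'rV[K]_(h i).+1) :
  (c *: sigma n x) *m slice_mx k i =
  (c * \prod_(j | j != i) x j ord0 (k j)) *: x i.
Proof.
by apply/rowP => a; rewrite slice_mxE segre_coord_sigma prod_upd mxE mulrA.
Qed.

(** For fixed [k], these equations say that the Segre image of the slices of [v]
    through [k] is [v] scaled by [segre_coord k v ^+ l.-1].  They replace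
    the usual quadrics, which would call for an induction on the number of
    swapped indices to recover [v] from its slices. *)
Definition segre_poly (k k' : multi_index) : {mpoly K[n.+1]} :=
  linform unpad_mx (segre_rank k) ^+ l.-1 * linform unpad_mx (segre_rank k')
  - \prod_i linform (slice_mx k i) (k' i).

Lemma segre_poly_homog k k' : homogeneous (segre_poly k k').
Proof.
have h1 := dhomogMn l.-1 (linform_homog unpad_mx (segre_rank k)).
have h2 := dhomogM h1 (linform_homog unpad_mx (segre_rank k')).
rewrite mul1n addn1 prednK // in h2.
have h3 := dhomog_bigprod (index_enum 'I_l)
             (fun i => linform_homog (slice_mx k i) (k' i)).
rewrite sum1_card card_ord in h3.
by exists l; rewrite rpredB.
Qed.

Lemma meval_segre_poly k k' v :
  peval (segre_poly k k') v =
  segre_coord k v ^+ l.-1 * segre_coord k' v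
  - \prod_i segre_coord (upd k (k' i)) v.
Proof.
rewrite mevalB mevalM rmorphXn rmorph_prod /= !meval_linform.
by congr (_ - _); apply: eq_bigr => i _; rewrite meval_linform slice_mxE.
Qed.

(** Each [f j] occurs once for every [i] other than [j]. *)
Lemma prod_prod_neq (f : 'I_l -> K) :
  \prod_i \prod_(j | j != i) f j = (\prod_i f i) ^+ l.-1.
Proof.
rewrite (exchange_big_dep predT) //= -prodrXl; apply: eq_bigr => j _.
rewrite (eq_bigl (predC1 j)) => [|i]; last by rewrite /= eq_sym.
by rewrite prodr_const cardC1 card_ord.
Qed.

Lemma segre_poly_sigma k k' c (x : forall i, 'rV[K]_(h i).+1) :
  peval (segre_poly k k') (c *: sigma n x) = 0.
Proof.
rewrite meval_segre_poly !segre_coord_sigma.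
apply/eqP; rewrite subr_eq0; apply/eqP.
under [RHS]eq_bigr do rewrite segre_coord_sigma prod_upd.
rewrite big_split big_split /= prodr_const card_ord.
rewrite prod_prod_neq exprMn -[X in c ^+ X * (_ * _)](prednK l_gt0) exprSr.
by rewrite -!mulrA; congr (_ * _); rewrite mulrCA.
Qed.

(** A point [v] killed by every form vanishing on the product variety is
    proportional to the Segre image of its slices through any nonzero coordinate,
    and each slice lies on its [X i], because the equations of [X i] evaluated at
    the slice are themselves forms in [v]. *)
Lemma pclosed_product_variety M X :
  (forall i, row_free (M i)) -> (forall i, pclosed (X i)) ->
  pclosed (product_variety M X).
Proof.
move=> fM cX.
have X0 i w : X i w -> w != 0 by have [S [_ XS]] := cX i; case/XS.
have x0 x : (forall i, X i (x i *m M i)) -> forall i, x i != 0.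
  by move=> Xx i; apply: contraTneq (X0 _ _ (Xx i)) => ->; rewrite mul0mx eqxx.
apply: pclosed_of_vanishing => [_ [x [/x0 nx [c c0 ->]]]|v v0 vI].
  by rewrite scaler_eq0 negb_or c0 sigma_neq0.
(* The coordinates of v beyond the first segre_dim h + 1 vanish. *)
have padK : v *m unpad_mx *m pid_mx (segre_dim h).+1 = v.
  apply/eqP; rewrite -subr_eq0 -mulmxA -[X in _ - X]mulmx1 -mulmxBr; apply/eqP.
  apply/rowP => j; rewrite -meval_linform mxE.
  apply: vI => [|_ [x [_ [c _ ->]]]].
    by exists 1%N; apply: linform_homog.
  rewrite meval_linform mulmxBr mulmx1 -scalemxAl mulmxA sigma_unpad subrr.
  by rewrite mxE.
have [m zm] : exists m, (v *m unpad_mx) ord0 m != 0.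
  by apply/rV0Pn; apply: contra_neq v0 => z0; rewrite -padK z0 mul0mx.
pose k := segre_index m.
have zk : segre_coord k v != 0 by rewrite /segre_coord segre_indexK.
pose x i := v *m slice_mx k i.
have xE : segre x = segre_coord k v ^+ l.-1 *: (v *m unpad_mx).
  apply/rowP => m'; rewrite -(segre_indexK m') segreE mxE.
  apply/esym/eqP; rewrite -subr_eq0.
  under eq_bigr do rewrite slice_mxE.
  rewrite -meval_segre_poly; apply/eqP/vI; first exact: segre_poly_homog.
  by move=> _ [y [_ [c _ ->]]]; apply: segre_poly_sigma.
exists x; split=> [i|]; last first.
  exists (segre_coord k v ^- l.-1); first by rewrite invr_eq0 expf_neq0.
  by rewrite /sigma xE -scalemxAl padK scalerK // expf_neq0.
have [S [hS XS]] := cX i; apply/XS; split=> [|p Sp].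
  rewrite mulmx_free_eq0 //; apply/rV0Pn; exists (k i).
  by rewrite slice_mxE upd_id.
rewrite -mulmxA -meval_pullback; have [d hp] := hS _ Sp.
apply: vI => [|_ [y [Xy [c _ ->]]]].
  by exists d; apply: pullback_homog.
rewrite meval_pullback mulmxA slice_sigma -scalemxAl.
rewrite (meval_dhomog_scale _ _ hp).
by have [_ ->] := (XS _).1 (Xy i); rewrite ?mulr0.
Qed.

End ProductVariety.

(** * Projective equivalence *)

Lemma hadamard_image_product (K : closedFieldType) (l n : nat) (h : 'I_l -> nat)
    (M : forall i, 'M[K]_((h i).+1, n.+1)) (X : 'I_l -> 'rV[K]_n.+1 -> Prop)
    (A : 'M[K]_n.+1) :
  (segre_dim h <= n)%N -> A \in unitmx ->
  hadamard_matrix M *m A = pid_mx (segre_dim h).+1 ->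
  (forall i v, X i v -> v != 0) ->
  (forall i v, X i v -> v \in param_space (M i)) ->
  forall v, hadamard_image X v <-> product_variety M X (v *m A).
Proof.
move=> le_Nn uA BA X0 XM.
have sigmaE x : sigma n x = (\row_j \prod_i (x i *m M i) ord0 j) *m A.
  by rewrite -segre_mul_hadamard_matrix -mulmxA BA.
move=> v; split=> [[_ [a [Xa [c c0 vE]]]]|[x [Xx [c c0 vE]]]].
  have aE i : a i *m pinvmx (M i) *m M i = a i.
    by apply: mulmxKpV; rewrite -mem_param_space; apply: XM.
  exists (fun i => a i *m pinvmx (M i)); split=> [i|]; first by rewrite aE.
  exists c => //; rewrite vE sigmaE -scalemxAl; congr (_ *: (_ *m _)).
  by apply/rowP => j; rewrite !mxE; apply: eq_bigr => i _; rewrite aE.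
split; last first.
  exists (fun i => x i *m M i); split=> //; exists c => //.
  by apply: (can_inj (mulmxK uA)); rewrite vE sigmaE scalemxAl.
have x0 i : x i != 0.
  by apply: contraTneq (X0 _ _ (Xx i)) => ->; rewrite mul0mx eqxx.
have : v *m A != 0 by rewrite vE scaler_eq0 negb_or c0 sigma_neq0.
by apply: contra_neq => ->; rewrite mul0mx.
Qed.

Unset Implicit Arguments.

Theorem theorem2p2 (K : closedFieldType) (charK0 : [pchar K] =i pred0)
    (l n : nat) (l_gt0 : (0 < l)%N) (h : 'I_l -> nat)
    (le_Nn : (segre_dim h <= n)%N) :
  exists2 U : ('I_l -> {vspace 'rV[K]_n.+1}) -> Prop,
    nonempty_open_tuples h U &
    forall (L : 'I_l -> {vspace 'rV[K]_n.+1})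
           (X : 'I_l -> 'rV[K]_n.+1 -> Prop)
           (M : forall i : 'I_l, 'M[K]_((h i).+1, n.+1)),
      (forall i, \dim (L i) = (h i).+1) -> U L ->
      (forall i, subvariety (X i)) ->
      (forall i, linear_span_is (X i) (L i)) ->
      (forall i, row_free (M i)) -> (forall i, param_space (M i) = L i) ->
      projectively_equivalent (hadamard_product X) (product_variety M X).
Proof.
(* A predicate on the spaces L i has to quantify over their parametrizations;
   UP says that one parametrization satisfies the condition only if all do. *)
pose U (L : 'I_l -> {vspace 'rV[K]_n.+1}) :=
  exists2 M : forall i, 'M[K]_((h i).+1, n.+1),
    forall i, param_space (M i) = L i & row_free (hadamard_matrix M).
have UP (M : forall i, 'M[K]_((h i).+1, n.+1)) L :
    (forall i, param_space (M i) = L i) -> U L ->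
    row_free (hadamard_matrix M).
  move=> ML [M' M'L fB'].
  have /mxrankS : (hadamard_matrix M' <= hadamard_matrix M)%MS.
    apply: hadamard_matrix_submx => i; apply/row_subP => a.
    by rewrite -mem_param_space ML -M'L mem_param_space row_sub.
  by rewrite (eqP fB') /row_free eqn_leq rank_leq_row.
exists U => [|L X M _ UL sX spX fM ML].
  have VE (M : forall i, 'M[K]_((h i).+1, n.+1)) :
      (forall i, row_free (M i)) /\ U (fun i => param_space (M i)) <->
      row_free (hadamard_matrix M).
    split=> [[_]|fB]; first exact: UP.
    by split=> [i|]; [exact: row_free_of_hadamard_matrix fB | exists M].
  split; last first.
    have [M fB] := exists_row_free_hadamard_matrix K le_Nn.
    by exists M; apply/VE.
  have [S SP] := zariski_open_row_free K n h.
  by exists S => M; rewrite VE.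
have fB := UP _ _ ML UL.
pose B := hadamard_matrix M.
pose P : 'M[K]_((segre_dim h).+1, n.+1) := pid_mx (segre_dim h).+1.
(* [pinvmx B *m P] sends B to P; it need not be invertible, but it agrees on the
   rows of B with an invertible matrix, the ranks of B and P being equal. *)
have BP : B *m (pinvmx B *m P) = P by rewrite mulmxA mulmxVp // mul1mx.
have [|A uA BA] := @complete_unitmx _ _ _ B (pinvmx B *m P).
  by rewrite BP rank_pid_mx // (eqP fB).
exists A => //; rewrite BP in BA.
apply: pclosure_id.
  apply: pclosed_preim uA _.
  by apply: pclosed_product_variety => // i; case: (sX i).
apply: hadamard_image_product => // i v Xv.
  have [[S [_ XS]] _] := sX i; by case/XS: Xv.
by rewrite ML; apply: (spX i).1.
Qed.
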